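(* Let $A\in\mathbb{R}^{m\times n}$ and let $r$ be an integer with $1\le r<\min\{m,n\}$. Let $A_\diamondsuit$ be an $r\times r$ submatrix of $A$ of maximal volume among all $r\times r$ submatrices of $A$. Let $I\subset\{1,\dots,m\}$ and $J\subset\{1,\dots,n\}$ with $\#(I)=\#(J)=r$ be such that $A_{I,J}$ is a (nonsingular) dominant submatrix of $A$ with $|\det(A_{I,J})|=\nu\,|\det(A_\diamondsuit)|$ for some $\nu\in(0,1]$. Let $A_r=A_{:,J}A_{I,J}^{-1}A_{I,:}$. Then $$\|A-A_r\|_C\le \frac{(r+1)\,\sigma_{r+1}(A)}{\nu\sqrt{1+\sum_{k=1}^{r}\frac{\sigma_{r+1}^2(A)}{\sigma_k^2(A)}}}.$$
   Context: For row indices $I$ and column indices $J$, $A_{I,:}$ is the submatrix of all rows of $A$ indexed by $I$, $A_{:,J}$ is the submatrix of all columns indexed by $J$, and $A_{I,J}$ is the submatrix on rows $I$ and columns $J$. The volume of a square matrix is the absolute value of its determinant. The Chebyshev norm is $\|A\|_C=\max_{i,j}|a_{ij}|$. $\sigma_1(A)\ge\sigma_2(A)\ge\cdots$ are the singular values of $A$ in decreasing order. A nonsingular $r\times r$ submatrix $B_\square$ of an $N\times r$ matrix $B$ ($N>r$) is called dominant if all entries of $BB_\square^{-1}$ are at most $1$ in modulus. For a general $m\times n$ matrix $A$, a nonsingular submatrix $A_{I,J}$ is dominant if all entries of $A_{:,J}A_{I,J}^{-1}$ and of $A_{I,J}^{-1}A_{I,:}$ are at most $1$ in modulus. *)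

(* Defs.v *)
From HB Require Import structures.
From mathcomp Require Import all_boot all_order all_algebra.
From mathcomp Require Import polyrcf.
From mathcomp Require Import reals matrix_normedtype.

Set Implicit Arguments.
Unset Strict Implicit.
Unset Printing Implicit Defensive.

Import Order.TTheory GRing.Theory Num.Theory.

Local Open Scope ring_scope.

(* A set of [r] indices, listed in increasing order.  The cardinality proof
   fixes the type of the submatrices below to ['M_r], so that they have a
   determinant and an inverse. *)
Definition idx (m r : nat) (I : {set 'I_m}) (cI : #|I| = r) (k : 'I_r) : 'I_m :=
  enum_val (cast_ord (esym cI) k).

Definition rows_of (R : realType) (m n r : nat) (A : 'M[R]_(m, n))
    (I : {set 'I_m}) (cI : #|I| = r) : 'M[R]_(r, n) :=
  rowsub (idx cI) A.

Definition cols_of (R : realType) (m n r : nat) (A : 'M[R]_(m, n))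
    (J : {set 'I_n}) (cJ : #|J| = r) : 'M[R]_(m, r) :=
  colsub (idx cJ) A.

Definition submat (R : realType) (m n r : nat) (A : 'M[R]_(m, n))
    (I : {set 'I_m}) (J : {set 'I_n}) (cI : #|I| = r) (cJ : #|J| = r) :
    'M[R]_r :=
  mxsub (idx cI) (idx cJ) A.

Definition volume (R : realType) (r : nat) (B : 'M[R]_r) : R := `|\det B|.

Definition max_volume (R : realType) (m n r : nat) (A : 'M[R]_(m, n))
    (I : {set 'I_m}) (J : {set 'I_n}) (cI : #|I| = r) (cJ : #|J| = r) : Prop :=
  forall (I' : {set 'I_m}) (J' : {set 'I_n}) (cI' : #|I'| = r) (cJ' : #|J'| = r),
    volume (submat A cI' cJ') <= volume (submat A cI cJ).

Definition dominant (R : realType) (m n r : nat) (A : 'M[R]_(m, n))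
    (I : {set 'I_m}) (J : {set 'I_n}) (cI : #|I| = r) (cJ : #|J| = r) : Prop :=
  [/\ submat A cI cJ \in unitmx,
      forall i j, `|(cols_of A cJ *m invmx (submat A cI cJ)) i j| <= 1
    & forall i j, `|(invmx (submat A cI cJ) *m rows_of A cI) i j| <= 1].

(* The real roots of a nonzero polynomial in decreasing order, each repeated
   according to its multiplicity. *)
Definition roots_desc (R : realType) (p : {poly R}) : seq R :=
  flatten [seq nseq (mup x p) x | x <- rev (rootsR p)].

(* The square roots of the eigenvalues of A^T A, with multiplicity and in
   decreasing order.  As A^T A is n x n, there are n of them: when m < n the
   list ends with n - m zeros in addition to the min(m, n) singular values. *)
Definition singular_values (R : realType) (m n : nat) (A : 'M[R]_(m, n)) :
    seq R :=
  [seq Num.sqrt x | x <- roots_desc (char_poly (A^T *m A))].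

(* Numbered from 1: [sigma A 1] is the largest singular value. *)
Definition sigma (R : realType) (m n : nat) (A : 'M[R]_(m, n)) (k : nat) : R :=
  nth 0 (singular_values A) k.-1.

(* [mx_norm] is the largest absolute value of an entry; see [mx_normrE]. *)
Definition chebyshev_norm (R : realType) (m n : nat) (A : 'M[R]_(m, n)) : R :=
  mx_norm A.

Definition cross_approx (R : realType) (m n r : nat) (A : 'M[R]_(m, n))
    (I : {set 'I_m}) (J : {set 'I_n}) (cI : #|I| = r) (cJ : #|J| = r) :
    'M[R]_(m, n) :=
  cols_of A cJ *m invmx (submat A cI cJ) *m rows_of A cI.

(* Main.v *)
(* Let (i, j) be the position of an entry gamma <> 0 of largest modulus of
   A - A_r, and let B be the square submatrix of A obtained from A_{I,J} by
   adding row i and column j.  By the Schur complement formula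
   |det B| = |gamma| |det A_{I,J}| = |gamma| nu V, with V the maximal volume.
   The r x r minors of B are at most V, so the entries of B^-1 are at most
   1 / (|gamma| nu), and
     sum_(k <= r+1) 1 / sigma_k(B)^2 = |B^-1|_F^2 <= ((r+1) / (|gamma| nu))^2.
   Since sigma_k(B) <= sigma_k(A) by interlacing, sigma_k(B) may be replaced by
   sigma_k(A) on the left; solving for |gamma| gives the bound.  Interlacing is
   proved over R[i], where the spectral theorem is available: it only needs the
   spectra of A^T A and B^T B to be real, not real eigenvectors. *)

Require Import Defs.
From HB Require Import structures.
From mathcomp Require Import all_boot all_order all_algebra.
From mathcomp Require Import perm polyrcf complex.
From mathcomp Require Import reals matrix_normedtype.
From mathcomp Require Import ring.

Set Implicit Arguments.
Unset Strict Implicit.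
Unset Printing Implicit Defensive.

Import Order.TTheory GRing.Theory Num.Theory.

Local Open Scope ring_scope.

(** * Root multisets and characteristic polynomials *)

Lemma sorted_flatten_nseq (T : eqType) (leT : rel T) (f : T -> nat) (s : seq T) :
  reflexive leT -> transitive leT -> sorted leT s ->
  sorted leT (flatten [seq nseq (f x) x | x <- s]).
Proof.
move=> le_refl le_trans; rewrite !(sorted_pairwise le_trans).
elim: s => //= x s IHs /andP[/allP le_xs /IHs sorted_s].
rewrite pairwise_cat sorted_s andbT; apply/andP; split.
  apply/allrelP => y z /nseqP[-> _] /flatten_mapP[t t_s /nseqP[-> _]].
  exact: le_xs.
by elim: (f x) => //= k ->; rewrite andbT; apply/allP => y /nseqP[-> _].
Qed.

(** Two lists sorted for an antisymmetric order agree once every element occurs equally often in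
    both, so only root multiplicities are compared. This gives access to [singular_values] once the
    characteristic polynomial is factored. *)
Lemma roots_desc_prod_XsubC (R : realType) (s : seq R) :
  sorted >=%R s -> roots_desc (\prod_(x <- s) ('X - x%:P)) = s.
Proof.
move=> sorted_s; set p := \prod_(x <- s) _.
have p_neq0 : p != 0 by rewrite monic_neq0 ?monic_prod_XsubC.
have ge_trans : transitive (>=%R : rel R) by move=> y x z /= yx /le_trans; apply.
apply: (sorted_eq ge_trans) => //.
- by move=> x y /andP[yx xy]; apply/le_anti/andP.
- apply: sorted_flatten_nseq; [exact: ge_refl | exact: ge_trans |].
  rewrite rev_sorted.
  by apply: (sub_sorted _ (sorted_roots _ _ _)) => x y /= /ltW.
apply/allP => x _ /=; apply/eqP.
rewrite -(mu_prod_XsubC x s) -/p count_flatten -map_comp.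
(* [rootsR p] has no repetition, so only the block of [x] itself contributes to the count. *)
have -> : [seq (count_mem x \o (fun y => nseq (mup y p) y)) y
             | y <- rev (rootsR p)]
  = [seq (if y == x then mup x p else 0)%N | y <- rev (rootsR p)].
  apply: eq_map => y /=; rewrite count_nseq /=.
  by case: eqP => [->|_]; rewrite ?mul1n ?mul0n.
rewrite sumnE big_map.
have uniq_r : uniq (rev (rootsR p)) by rewrite rev_uniq uniq_roots.
case: (boolP (x \in rev (rootsR p))) => [x_in|x_out].
  rewrite (bigD1_seq x) //= eqxx big1 ?addn0 // => y /negPf ->; by [].
rewrite big1_seq => [|y /= y_in]; last first.
  by case: eqP => // eq_yx; rewrite eq_yx (negPf x_out) in y_in.
rewrite mupNroot //; apply: contra x_out => px0.
by rewrite mem_rev -(roots_on_rootsR p_neq0) inE.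
Qed.

Lemma char_poly_conjugate (F : fieldType) n (P D : 'M[F]_n) :
  P \in unitmx -> char_poly (invmx P *m D *m P) = char_poly D.
Proof.
move=> P_unit; rewrite /char_poly.
have PP : map_mx polyC (invmx P) *m map_mx polyC P = 1%:M.
  by rewrite -map_mxM mulVmx // map_mx1.
have -> : char_poly_mx (invmx P *m D *m P) =
    map_mx polyC (invmx P) *m char_poly_mx D *m map_mx polyC P.
  rewrite /char_poly_mx mulmxBr mulmxBl !map_mxM scalar_mxC.
  by rewrite -(mulmxA 'X%:M) PP mulmx1.
by rewrite !det_mulmx mulrAC -det_mulmx PP det1 mul1r.
Qed.

(** * Spectral theorem over [R[i]], interlacing and singular values *)

Section Spectral.
Local Open Scope sesquilinear_scope.
Local Notation toC := (real_complex _).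

(** Over [R[i]] the matrix is Hermitian, hence unitarily diagonalizable with real eigenvalues: [P]
    is complex while [d] stays real. *)
Lemma symmetric_spectral (R : rcfType) n (A : 'M[R]_n) : A^T = A ->
  exists P : 'M[R[i]]_n, exists d : 'rV[R]_n,
  [/\ P \is unitarymx,
      forall i j : 'I_n, (i <= j)%N -> d 0 j <= d 0 i
    & map_mx toC A = P^t* *m diag_mx (map_mx toC d) *m P].
Proof.
move=> A_sym; set AC := map_mx _ A.
have AC_herm : AC \is hermsymmx.
  apply/is_hermitianmxP; rewrite expr0 scale1r.
  apply/matrixP=> i j; rewrite !mxE.
  rewrite -{1}A_sym mxE; apply/esym/CrealP/complex_realP.
  by exists (A j i).
have /orthomx_spectralP := hermitian_normalmx AC_herm.
have := hermitian_spectral_diag_real AC_herm.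
have := spectral_unitarymx AC.
move: (spectralmx AC) (spectral_diag AC) => P d P_unitary d_real AC_eq.
pose e : n.-tuple R := [tuple complex.Re (d 0 i) | i < n].
have ge_total : total (>=%R : rel R) by move=> x y; exact: le_total.
have ge_trans : transitive (>=%R : rel R) by move=> y x z /= yx /le_trans; apply.
(* The permutation that sorts the eigenvalues decreasingly is also applied to the rows of [P]. *)
have : perm_eq (sort >=%R e) e by rewrite perm_sort.
case/tuple_permP => s sort_e.
exists (row_perm s P), (\row_i complex.Re (d 0 (s i))).
have P_unit := unitarymx_unit P_unitary.
split.
- apply/unitarymxP; move/unitarymxP: P_unitary => PP.
  apply/matrixP => i j; move/matrixP/(_ (s i) (s j)): PP.
  rewrite !mxE (inj_eq perm_inj) => <-.
  by apply: eq_bigr => k _; rewrite !mxE.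
- move=> i j le_ij; rewrite !mxE.
  have nthE k : complex.Re (d 0 (s k)) = nth 0 (sort >=%R e) k.
    by rewrite sort_e -[RHS](tnth_nth 0 (mktuple _)) !tnth_mktuple.
  rewrite !nthE.
  have in_sort (k : 'I_n) : (k < size (sort >=%R e))%N.
    by rewrite size_sort size_tuple.
  exact: (sorted_leq_nth ge_trans ge_refl 0 (sort_sorted ge_total e)
            i j (in_sort i) (in_sort j) le_ij).
rewrite AC_eq invmx_unitary //.
apply/matrixP => i j; rewrite !mxE.
rewrite (reindex_inj (@perm_inj _ s)) /=.
apply: eq_bigr => k _; rewrite !mul_mx_diag !mxE.
by rewrite RRe_real //; move/mxOverP: d_real; apply.
Qed.

Lemma char_poly_spectral (R : rcfType) n (A : 'M[R]_n) (P : 'M[R[i]]_n) (d : 'rV[R]_n) :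
  P \is unitarymx ->
  map_mx toC A = P^t* *m diag_mx (map_mx toC d) *m P ->
  char_poly A = \prod_(x <- [seq d 0 i | i <- enum 'I_n]) ('X - x%:P).
Proof.
move=> P_unitary A_eq; apply: (map_poly_inj (real_complex R)).
rewrite map_char_poly A_eq -invmx_unitary // char_poly_conjugate; last first.
  exact: unitarymx_unit.
rewrite char_poly_trig ?diag_mx_is_trig // big_map big_enum /= rmorph_prod.
by apply: eq_bigr => i _; rewrite [RHS]map_polyXsubC !mxE eqxx.
Qed.

Lemma mul_trmxCE (R : rcfType) n (u : 'rV[R[i]]_n) : (u *m u^t*) 0 0 = \sum_i `|u 0 i| ^+ 2.
Proof. by rewrite mxE; apply: eq_bigr => i _; rewrite !mxE normCK. Qed.

Lemma diag_formE (R : rcfType) n (d : 'rV[R]_n) (u : 'rV[R[i]]_n) :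
  (u *m diag_mx (map_mx toC d) *m u^t*) 0 0 = \sum_i toC (d 0 i) * `|u 0 i| ^+ 2.
Proof.
rewrite mul_mx_diag mxE; apply: eq_bigr => i _.
by rewrite !mxE normCK mulrAC mulrC.
Qed.

Lemma unitary_formE (R : rcfType) m n (U : 'M[R[i]]_(m, n)) (u : 'rV_m) :
  U \is unitarymx -> (u *m U) *m (u *m U)^t* = u *m u^t*.
Proof.
by move=> U_unitary; rewrite trmx_mul map_mxM mulmxA mulmxtVK.
Qed.

Lemma mul_trmxC_gt0 (R : rcfType) n (u : 'rV[R[i]]_n) : u != 0 -> 0 < (u *m u^t*) 0 0.
Proof.
move=> u_neq0; rewrite mul_trmxCE lt_neqAle sumr_ge0 ?andbT => [|i _]; last first.
  exact: exprn_ge0.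
apply: contraNneq u_neq0 => /esym/eqP; rewrite psumr_eq0 => [/allP u0|i _].
  apply/eqP/rowP => i; rewrite mxE; apply/eqP.
  by have := u0 i (mem_index_enum i); rewrite /= sqrf_eq0 normr_eq0.
exact: exprn_ge0.
Qed.

Lemma spectral_formE (R : rcfType) n (P : 'M[R[i]]_n) (d : 'rV[R]_n) (y : 'rV_n) :
  y *m (P^t* *m diag_mx (map_mx toC d) *m P) *m y^t*
  = (y *m P^t*) *m diag_mx (map_mx toC d) *m (y *m P^t*)^t*.
Proof.
rewrite trmx_mul map_mxM /= map_trmx trmxK -map_mx_comp.
by rewrite (map_mx_id (@conjCK _)) !mulmxA.
Qed.

(* The span of the first [i.+1] rows of [Q] contains a nonzero [y] such that
   [y *m E] is orthogonal to the first [i] rows of [P]; both quadratic forms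
   are compared at [y]. *)
Lemma spectral_interlacing (R : rcfType) n s (P : 'M[R[i]]_n) (Q : 'M[R[i]]_s)
    (d : 'rV[R]_n) (e : 'rV[R]_s) (E : 'M[R[i]]_(s, n)) :
  P \is unitarymx -> Q \is unitarymx -> E \is unitarymx ->
  (forall i j : 'I_n, (i <= j)%N -> d 0 j <= d 0 i) ->
  (forall i j : 'I_s, (i <= j)%N -> e 0 j <= e 0 i) ->
  (forall y : 'rV_s,
    (y *m (Q^t* *m diag_mx (map_mx toC e) *m Q) *m y^t*) 0 0 <=
    ((y *m E) *m (P^t* *m diag_mx (map_mx toC d) *m P) *m (y *m E)^t*) 0 0) ->
  forall (i : 'I_s) (j : 'I_n), i = j :> nat -> e 0 i <= d 0 j.
Proof.
move=> P_unitary Q_unitary E_unitary d_anti e_anti le_form i j eq_ij.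
have le_in : (i <= n)%N by rewrite eq_ij ltnW.
pose T := rowsub (widen_ord (ltn_ord i)) Q.
pose K := colsub (widen_ord le_in) (T *m E *m P^t*).
(* [K] has [i.+1] rows but only [i] columns, so its left kernel is nonzero. *)
have K_ker : kermx K != 0.
  rewrite kermx_eq0 /row_free neq_ltn; apply/orP; left.
  by rewrite ltnS rank_leq_col.
have [w w_ker w_neq0] := rowV0Pn K_ker.
have T_unitary : T \is unitarymx.
  apply/unitarymxP/matrixP => a b; move/unitarymxP/matrixP: Q_unitary.
  move=> /(_ (widen_ord (ltn_ord i) a) (widen_ord (ltn_ord i) b)).
  rewrite !mxE -val_eqE /= val_eqE => <-.
  by apply: eq_bigr => c _; rewrite !mxE.
pose y := w *m T.
have yy_gt0 : 0 < (y *m y^t*) 0 0 by rewrite unitary_formE // mul_trmxC_gt0.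
have Qt_unitary : Q^t* \is unitarymx by rewrite trmxC_unitary.
have Pt_unitary : P^t* \is unitarymx by rewrite trmxC_unitary.
(* The chain is e_i |y|^2 <= form of [Q] at [y] <= form of [P] at [y *m E] <= d_j |y|^2. In the
   outer steps, the coordinates whose eigenvalues compare the wrong way vanish. *)
rewrite -lecR -(ler_pM2r yy_gt0).
apply: le_trans (le_trans (le_form y) _).
  rewrite spectral_formE // diag_formE -(unitary_formE y Qt_unitary) mul_trmxCE.
  rewrite mulr_sumr; apply: ler_sum => l _.
  have [le_li|lt_il] := leqP l i.
    by rewrite ler_wpM2r ?exprn_ge0 // lecR e_anti.
  suff -> : (y *m Q^t*) 0 l = 0 by rewrite normr0 expr0n !mulr0.
  rewrite -mulmxA mxE big1 // => a _; move/unitarymxP/matrixP: Q_unitary.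
  move=> /(_ (widen_ord (ltn_ord i) a) l).
  rewrite /T mul_rowsub_mx [_ a l]mxE => ->.
  by rewrite mxE -val_eqE /= ltn_eqF ?mulr0 // (leq_trans (ltn_ord a)).
rewrite spectral_formE // diag_formE -(unitary_formE y E_unitary).
rewrite -(unitary_formE _ Pt_unitary) mul_trmxCE mulr_sumr; apply: ler_sum => l _.
have [le_jl|lt_lj] := leqP j l.
  by rewrite ler_wpM2r ?exprn_ge0 // lecR d_anti.
suff -> : (y *m E *m P^t*) 0 l = 0 by rewrite normr0 expr0n !mulr0.
have lt_li : (l < i)%N by rewrite eq_ij.
move/sub_kermxP/rowP: w_ker => /(_ (Ordinal lt_li)).
rewrite /K mulmx_colsub [LHS]mxE [RHS]mxE !mulmxA.
by have -> : widen_ord le_in (Ordinal lt_li) = l by apply: val_inj.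
Qed.

(** The factored characteristic polynomial turns [roots_desc] into the list of entries of [d];
    numbering singular values from 1 accounts for [k.+1]. *)
Lemma sigma_spectral (R : realType) m n (A : 'M[R]_(m, n))
    (P : 'M[R[i]]_n) (d : 'rV[R]_n) :
  P \is unitarymx -> (forall i j : 'I_n, (i <= j)%N -> d 0 j <= d 0 i) ->
  map_mx toC (A^T *m A) = P^t* *m diag_mx (map_mx toC d) *m P ->
  forall k : 'I_n, sigma A k.+1 = Num.sqrt (d 0 k).
Proof.
move=> P_unitary d_anti AA_eq k.
rewrite /sigma /singular_values (char_poly_spectral P_unitary AA_eq).
rewrite roots_desc_prod_XsubC; last first.
  rewrite sorted_map.
  have : sorted leq (map val (enum 'I_n)) by rewrite val_enum_ord iota_sorted.
  by rewrite sorted_map; apply: sub_sorted => i j /= /d_anti.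
rewrite -map_comp (nth_map k) ?size_enum_ord //=.
by rewrite nth_ord_enum.
Qed.

Lemma gram_formE (R : rcfType) m n (A : 'M[R]_(m, n)) (y : 'rV[R[i]]_n) :
  let AC := map_mx toC A in
  y *m map_mx toC (A^T *m A) *m y^t*
  = (y *m AC^T) *m (y *m AC^T)^t*.
Proof.
move=> AC; rewrite trmx_mul trmxK !map_mxM /= -map_trmx !mulmxA; congr (_ *m _ *m _).
apply/matrixP => i j; rewrite !mxE; apply/esym/CrealP/complex_realP.
by exists (A i j).
Qed.

(** The sum of squares is the trace of B^-1 B^-T = (B^T B)^-1, whose eigenvalues are the 1 / d_k.
    Each d_k is the Gram form at row [k] of [P], hence positive as [B] is nonsingular. *)
Lemma sum_sqr_invmx_spectral (R : rcfType) n (B : 'M[R]_n)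
    (P : 'M[R[i]]_n) (d : 'rV[R]_n) :
  B \in unitmx -> P \is unitarymx ->
  map_mx toC (B^T *m B) = P^t* *m diag_mx (map_mx toC d) *m P ->
  (forall k, 0 < d 0 k)
  /\ \sum_i \sum_j invmx B i j ^+ 2 = \sum_k (d 0 k)^-1.
Proof.
move=> B_unit P_unitary BB_eq.
have P_unit := unitarymx_unit P_unitary.
have PP : P *m P^t* = 1%:M by apply/unitarymxP.
split=> [k|].
  pose y := row k P.
  have yP : y *m P^t* = delta_mx 0 k by rewrite -row_mul PP row1.
  have : 0 < (y *m map_mx toC (B^T *m B) *m y^t*) 0 0.
    rewrite gram_formE; apply: mul_trmxC_gt0.
    rewrite mulmx_free_eq0; last by rewrite row_free_unit unitmx_tr map_unitmx.
    apply/eqP => y0; move/matrixP/(_ 0 k): yP; rewrite y0 mul0mx !mxE !eqxx.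
    by move/esym/eqP; rewrite oner_eq0.
  rewrite BB_eq spectral_formE yP diag_formE (bigD1 k) //= big1 ?addr0.
    by rewrite !mxE !eqxx normr1 expr1n mulr1 ltcR.
  by move=> l /negPf l_neq; rewrite !mxE l_neq andbF normr0 expr0n mulr0.
pose N := invmx B *m (invmx B)^T.
have -> : \sum_i \sum_j invmx B i j ^+ 2 = \tr N.
  rewrite /mxtrace; apply: eq_bigr => i _; rewrite mxE.
  by apply: eq_bigr => j _; rewrite mxE expr2.
have NB : N *m (B^T *m B) = 1%:M.
  rewrite /N mulmxA -(mulmxA (invmx B)) -trmx_mul mulmxV //.
  by rewrite trmx1 mulmx1 mulVmx.
(* In the eigenbasis the inverse of B^T B becomes [M], whose diagonal entries are the 1 / d_k;
   conjugation preserves the trace. *)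
pose M := P *m map_mx toC N *m P^t*.
have MD : M *m diag_mx (map_mx toC d) = 1%:M.
  have : map_mx toC N *m map_mx toC (B^T *m B) = 1%:M.
    by rewrite -map_mxM NB map_mx1.
  rewrite BB_eq !mulmxA => /(congr1 (fun X => P *m X *m P^t*)).
  by rewrite mulmx1 PP -!mulmxA PP mulmx1 !mulmxA.
apply: (fmorph_inj (real_complex R)).
transitivity (\tr M).
  by rewrite -trace_map_mx mxtrace_mulC mulmxA -invmx_unitary // mulVmx // mul1mx.
rewrite rmorph_sum; apply: eq_bigr => k _; rewrite fmorphV.
move/matrixP/(_ k k): MD; rewrite mul_mx_diag [LHS]mxE [RHS]mxE eqxx.
rewrite [map_mx _ _ _ _]mxE => MD1.
have dk_neq0 : toC (d 0 k) != 0.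
  by apply: contra_eq_neq MD1 => ->; rewrite mulr0 eq_sym oner_eq0.
by apply: (mulIf dk_neq0); rewrite MD1 mulVf.
Qed.

(** Interlacing bounds each eigenvalue of the Gram matrix of the submatrix by that of A^T A with the
    same rank in decreasing order; inverting reverses the inequality. Rows and columns are removed
    in a single step. *)
Lemma sum_sigma_submatrix (R : realType) m n s (A : 'M[R]_(m, n))
    (f : 'I_s -> 'I_m) (g : 'I_s -> 'I_n) :
  injective f -> injective g -> mxsub f g A \in unitmx ->
  (forall k : 'I_s, 0 < sigma A k.+1) /\
  \sum_(k < s) (sigma A k.+1 ^+ 2)^-1
    <= \sum_i \sum_j invmx (mxsub f g A) i j ^+ 2.
Proof.
move=> f_inj g_inj; set B := mxsub f g A => B_unit.
have le_sn : (s <= n)%N by have := leq_card g g_inj; rewrite !card_ord.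
have gram_sym p q (C : 'M[R]_(p, q)) : (C^T *m C)^T = C^T *m C.
  by rewrite trmx_mul trmxK.
have [P [d [P_unitary d_anti AA_eq]]] := symmetric_spectral (gram_sym _ _ A).
have [Q [e [Q_unitary e_anti BB_eq]]] := symmetric_spectral (gram_sym _ _ B).
have [e_gt0 ->] := sum_sqr_invmx_spectral B_unit Q_unitary BB_eq.
(* [E] extends a vector by zero from the columns picked by [g] to all [n] columns. *)
pose E : 'M[R[i]]_(s, n) := rowsub g 1%:M.
have E_unitary : E \is unitarymx.
  apply/unitarymxP/matrixP => a b; rewrite !mxE (bigD1 (g b)) //= big1 ?addr0.
    by rewrite !mxE eqxx conjC1 mulr1 (inj_eq g_inj).
  by move=> l l_neq; rewrite !mxE [g b == l]eq_sym (negPf l_neq) conjC0 mulr0.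
have le_ed (k : 'I_s) : e 0 k <= d 0 (widen_ord le_sn k).
  apply: (spectral_interlacing P_unitary Q_unitary E_unitary) => // y.
  rewrite -AA_eq -BB_eq !gram_formE !mul_trmxCE.
  set v := y *m E *m _.
  (* The entries on the left are those of [v] at the rows picked by [f], so the form of [B] is a
     partial sum of the form of [A]. *)
  have -> : y *m (map_mx toC B)^T = colsub f v.
    rewrite /v -mulmxA -mulmx_colsub; congr (_ *m _).
    rewrite /E mul_rowsub_mx mul1mx.
    by apply/matrixP => a b; rewrite !mxE.
  rewrite (eq_bigr (fun i => `|v 0 (f i)| ^+ 2)) => [|i _]; last by rewrite mxE.
  rewrite -(big_imset (fun j => `|v 0 j| ^+ 2) (in2W f_inj)).
  rewrite [leRHS](bigID [in f @: 'I_s]) /= lerDl sumr_ge0 // => j _.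
  exact: exprn_ge0.
have sigmaE (k : 'I_s) : sigma A k.+1 = Num.sqrt (d 0 (widen_ord le_sn k)).
  by rewrite -(sigma_spectral P_unitary d_anti AA_eq).
have d_gt0 (k : 'I_s) : 0 < d 0 (widen_ord le_sn k).
  exact: lt_le_trans (e_gt0 k) (le_ed k).
split=> [k|]; first by rewrite sigmaE sqrtr_gt0.
apply: ler_sum => k _; rewrite sigmaE sqr_sqrtr ?(ltW (d_gt0 k)) //.
by rewrite lef_pV2 ?posrE.
Qed.

End Spectral.

(** * Bordered determinants and minors bounded by the maximal volume *)

(** Eliminating [v] with the invertible corner [M] leaves a block lower triangular factor whose
    upper left block is the Schur complement. *)
Lemma det_bordered (F : fieldType) r (a : 'M[F]_1) (v : 'rV_r) (u : 'cV_r)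
    (M : 'M_r) :
  M \in unitmx ->
  \det (block_mx a v u M) = (a - v *m invmx M *m u) 0 0 * \det M.
Proof.
move=> M_unit.
have -> : block_mx a v u M = block_mx 1%:M (v *m invmx M) 0 1%:M
    *m block_mx (a - v *m invmx M *m u) 0 u M.
  by rewrite mulmx_block !mul1mx !mul0mx !add0r mulmxKV // subrK.
by rewrite det_mulmx det_lblock det_ublock !det1 !mul1r det_mx11.
Qed.

(** [max_volume] ranges over increasingly listed index sets. An injective listing differs from the
    increasing one by a permutation, which changes the determinant only by a sign. *)
Lemma volume_le_max_volume (R : realType) m n r (A : 'M[R]_(m, n))
    (I : {set 'I_m}) (J : {set 'I_n}) (cI : #|I| = r) (cJ : #|J| = r)
    (f : 'I_r -> 'I_m) (g : 'I_r -> 'I_n) :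
  max_volume A cI cJ -> injective f -> injective g ->
  volume (mxsub f g A) <= volume (submat A cI cJ).
Proof.
move=> maxIJ f_inj g_inj.
have idx_perm p (h : 'I_r -> 'I_p) : injective h ->
    exists K : {set 'I_p}, exists cK : #|K| = r, exists s : 'S_r,
      h =1 idx cK \o s.
  move=> h_inj; pose K := h @: 'I_r.
  have cK : #|K| = r by rewrite card_imset // card_ord.
  have hK i : h i \in K by apply: imset_f.
  pose t i := cast_ord cK (enum_rank_in (hK i) (h i)).
  have tE i : idx cK (t i) = h i by rewrite /idx cast_ordK enum_rankK_in.
  have t_inj : injective t by move=> i j /(congr1 (idx cK)); rewrite !tE => /h_inj.
  by exists K, cK, (perm t_inj) => i /=; rewrite permE tE.
have [I' [cI' [s fE]]] := idx_perm _ f f_inj.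
have [J' [cJ' [t gE]]] := idx_perm _ g g_inj.
apply: le_trans (maxIJ I' J' cI' cJ'); rewrite /volume.
have -> : mxsub f g A = row_perm s (col_perm t (submat A cI' cJ')).
  by apply/matrixP => i j; rewrite !mxE fE gE.
rewrite row_permE col_permE !det_mulmx !det_perm !normrM !normrX normrN1 !expr1n.
by rewrite mul1r mulr1.
Qed.

(** A repeated row or column makes the determinant vanish. *)
Lemma det_mxsub_neq0_inj (R : comRingType) m n s (A : 'M[R]_(m, n))
    (f : 'I_s -> 'I_m) (g : 'I_s -> 'I_n) :
  \det (mxsub f g A) != 0 -> injective f /\ injective g.
Proof.
move=> det_neq0; split=> a b eq_ab; apply: contraNeq det_neq0 => neq_ab.
  apply/eqP/(determinant_alternate neq_ab) => k; by rewrite !mxE eq_ab.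
rewrite -det_tr; apply/eqP/(determinant_alternate neq_ab) => k.
by rewrite !mxE eq_ab.
Qed.

(** By Cramer's rule an entry of the inverse is a cofactor over the determinant, and each cofactor
    is, up to sign, an r x r minor of [A]. *)
Lemma invmx_mxsub_le (R : realType) m n r (A : 'M[R]_(m, n))
    (I : {set 'I_m}) (J : {set 'I_n}) (cI : #|I| = r) (cJ : #|J| = r)
    (f : 'I_r.+1 -> 'I_m) (g : 'I_r.+1 -> 'I_n) :
  max_volume A cI cJ -> mxsub f g A \in unitmx ->
  forall i j, `|invmx (mxsub f g A) i j|
    <= volume (submat A cI cJ) / volume (mxsub f g A).
Proof.
move=> maxIJ B_unit i j.
have det_neq0 : \det (mxsub f g A) != 0 by rewrite -unitfE.
have [f_inj g_inj] := det_mxsub_neq0_inj det_neq0.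
rewrite /invmx B_unit !mxE normrM normfV mulrC ler_wpM2r ?invr_ge0 //.
rewrite /cofactor normrM normrX normrN1 expr1n mul1r.
have -> : row' j (col' i (mxsub f g A)) = mxsub (f \o lift j) (g \o lift i) A.
  by apply/matrixP => a b; rewrite !mxE.
by apply: volume_le_max_volume => //; apply: inj_comp => //; apply: lift_inj.
Qed.

Theorem theorem4 (R : realType) (m n r : nat) (A : 'M[R]_(m, n))
    (r_gt0 : (1 <= r)%N) (r_lt : (r < minn m n)%N)
    (I0 : {set 'I_m}) (J0 : {set 'I_n}) (cI0 : #|I0| = r) (cJ0 : #|J0| = r)
    (maxIJ0 : max_volume A cI0 cJ0)
    (I : {set 'I_m}) (J : {set 'I_n}) (cI : #|I| = r) (cJ : #|J| = r)
    (domIJ : dominant A cI cJ)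
    (nu : R) (nu_gt0 : 0 < nu) (nu_le1 : nu <= 1)
    (volIJ : volume (submat A cI cJ) = nu * volume (submat A cI0 cJ0)) :
  chebyshev_norm (A - cross_approx A cI cJ)
  <= (r.+1%:R * sigma A r.+1)
     / (nu * Num.sqrt (1 + \sum_(1 <= k < r.+1) sigma A r.+1 ^+ 2 / sigma A k ^+ 2)).
Proof.
have sigma_ge0 k : 0 <= sigma A k.
  rewrite /sigma /singular_values.
  have [k_lt|/(nth_default 0) -> //] := ltnP k.-1 (size (singular_values A)).
  by rewrite (nth_map 0) ?sqrtr_ge0 //; move: k_lt; rewrite size_map.
set err := A - _; rewrite /chebyshev_norm.
(* A zero error only requires the right-hand side to be nonnegative; otherwise the norm is attained
   at some entry. *)
have [->|err_neq0] := eqVneq (mx_norm err) 0.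
  by rewrite divr_ge0 ?mulr_ge0 ?sqrtr_ge0 ?ler0n // ltW.
have [[i j] /= normE] := mx_norm_neq0 err_neq0.
have gamma_gt0 : 0 < `|err i j|.
  by rewrite -normE lt_neqAle eq_sym err_neq0 normE normr_ge0.
rewrite normE; set gamma := `|err i j| in gamma_gt0 *.
have [M_unit _ _] := domIJ; set M := submat A cI cJ in M_unit volIJ.
(* The bordering row [i] and column [j] come first, so that [B] splits into blocks along 1 + r. *)
pose f : 'I_r.+1 -> 'I_m :=
  fun k => if unlift ord0 k is Some l then idx cI l else i.
pose g : 'I_r.+1 -> 'I_n :=
  fun k => if unlift ord0 k is Some l then idx cJ l else j.
pose B := mxsub f g A.
have detB : \det B = err i j * \det M.
  have -> : B = block_mx (A i j)%:M (row i (cols_of A cJ))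
                         (col j (rows_of A cI)) M :> 'M_(1 + r).
    apply/matrixP => k l.
    case: (split_ordP k) => k' ->; case: (split_ordP l) => l' ->;
      rewrite ?block_mxEul ?block_mxEur ?block_mxEdl ?block_mxEdr ?ord1;
      rewrite ?lshift0 ?rshift1 !mxE /f /g ?liftK ?unlift_none //.
  rewrite det_bordered //; congr (_ * _).
  rewrite -row_mul !mxE eqxx mulr1n; congr (_ - _).
  by apply: eq_bigr => k _; rewrite !mxE.
have volB : volume B = gamma * (nu * volume (submat A cI0 cJ0)).
  by rewrite -volIJ /volume detB normrM.
have vol_gt0 : 0 < volume (submat A cI0 cJ0).
  by rewrite -(pmulr_rgt0 _ nu_gt0) -volIJ normr_gt0 -unitfE.
have B_unit : B \in unitmx.
  rewrite unitmxE unitfE -normr_gt0 -/(volume B) volB.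
  by rewrite !mulr_gt0.
(* As [B] is nonsingular, [i] lies outside [I] and [j] outside [J]. *)
have [f_inj g_inj] : injective f /\ injective g.
  by apply: (@det_mxsub_neq0_inj _ _ _ _ A); rewrite -unitfE.
have [sigma_gt0 sum_le] := sum_sigma_submatrix f_inj g_inj B_unit.
(* Each of the (r+1)^2 entries of the inverse of [B] has modulus at most 1 / (gamma nu): the maximal
   volume cancels. *)
have {}sum_le :
    \sum_(k < r.+1) (sigma A k.+1 ^+ 2)^-1 <= (r.+1%:R / (gamma * nu)) ^+ 2.
  apply: le_trans sum_le _.
  apply: (@le_trans _ _
    (\sum_(k < r.+1) \sum_(l < r.+1) (gamma * nu)^-1 ^+ 2)).
    apply: ler_sum => k _; apply: ler_sum => l _.
    rewrite -real_normK ?num_real // ler_pXn2r ?nnegrE //; last first.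
      by rewrite ltW // invr_gt0 mulr_gt0.
    apply: le_trans (invmx_mxsub_le maxIJ0 B_unit k l) _.
    by rewrite -/B volB mulrA invfM mulrA mulrC mulrA mulVf ?mul1r // gt_eqF.
  rewrite !sumr_const !card_ord -mulrnA -[leLHS]mulr_natr natrM.
  by rewrite exprMn mulrC [r.+1%:R ^+ 2]expr2.
set S := \sum_(k < _) _ in sum_le.
have sigma_r_gt0 : 0 < sigma A r.+1 := sigma_gt0 ord_max.
(* The leading 1 is the term for k = r + 1, so the square of [sigma A r.+1] factors out. *)
have -> : 1 + \sum_(1 <= k < r.+1) sigma A r.+1 ^+ 2 / sigma A k ^+ 2
    = sigma A r.+1 ^+ 2 * S.
  rewrite big_add1 big_mkord /S big_ord_recr /= mulrDr addrC mulfV; last first.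
    by rewrite expf_neq0 // gt_eqF.
  by rewrite mulr_sumr.
have S_gt0 : 0 < S.
  rewrite /S big_ord_recr /= ltr_wpDl ?invr_gt0 ?exprn_gt0 //.
  by apply: sumr_ge0 => k _; rewrite invr_ge0 exprn_ge0.
rewrite sqrtrM ?sqr_ge0 // sqrtr_sqr ger0_norm //.
have sqrtS_gt0 : 0 < Num.sqrt S by rewrite sqrtr_gt0.
have -> : r.+1%:R * sigma A r.+1 / (nu * (sigma A r.+1 * Num.sqrt S))
    = r.+1%:R / (nu * Num.sqrt S).
  by field; rewrite !gt_eqF.
(* Rearranged, this is the remaining goal gamma <= (r+1) / (nu sqrt S). *)
have : Num.sqrt S <= r.+1%:R / (gamma * nu).
  rewrite -(@ler_pXn2r _ 2) ?nnegrE ?sqrtr_ge0 //; last first.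
    by rewrite divr_ge0 ?ler0n // mulr_ge0 // ltW.
  by rewrite sqr_sqrtr // ltW.
rewrite !ler_pdivlMr ?mulr_gt0 //.
by rewrite mulrCA [nu * _]mulrC mulrCA mulrC.
Qed.
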